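(* Let $P$ be a nice polygon with an even number $n$ of vertices $A_0,\dots,A_{n-1}$ (indices mod $n$) and center $O$, and let $f\colon P\to\mathbb{R}$ be convex on every triangle $OA_kA_{k+1}$, $k=0,\dots,n-1$. Then $$\operatorname{Avg}(f,P)\le\frac13\cdot\frac{1}{n/2}\sum_{k\ \mathrm{odd}}f(A_k)+\frac23\cdot\frac{1}{n/2}\sum_{k\ \mathrm{even}}\operatorname{Avg}(f,OA_k),$$ $$\operatorname{Avg}(f,P)\le\frac13\cdot\frac{1}{n/2}\sum_{k\ \mathrm{even}}f(A_k)+\frac23\cdot\frac{1}{n/2}\sum_{k\ \mathrm{odd}}\operatorname{Avg}(f,OA_k),$$ where the sums run over $k\in\{0,\dots,n-1\}$.
   Context: A nice polygon is a star-shaped polygon $P$ with vertices $A_0,\dots,A_{n-1}$ for which there exists a point $O$ (called its center) in the kernel of $P$ such that all triangles $OA_kA_{k+1}$, $k=0,\dots,n-1$ (indices mod $n$), have the same area. $\operatorname{Avg}(f,P)$ is the average of $f$ over $P$ with respect to area, and $\operatorname{Avg}(f,OA_k)$ is the average of $f$ over the segment $OA_k$ with respect to length. *)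

(* Defs.v *)
From HB Require Import structures.
From mathcomp Require Import all_boot all_order all_algebra.
From mathcomp Require Import all_classical all_reals all_analysis.
Set Implicit Arguments. Unset Strict Implicit. Unset Printing Implicit Defensive.
Import Order.TTheory GRing.Theory Num.Theory.
Import numFieldNormedType.Exports.
Local Open Scope classical_set_scope.
Local Open Scope ring_scope.

Section Plane.
Variable R : realType.
Definition pt := (R * R)%type.

Definition lerp (p q : pt) (t : R) : pt :=
  ((1 - t) * p.1 + t * q.1, (1 - t) * p.2 + t * q.2).

Definition det2 (O A B : pt) : R :=
  (A.1 - O.1) * (B.2 - O.2) - (A.2 - O.2) * (B.1 - O.1).

Definition tri_area (O A B : pt) : R := `|det2 O A B| / 2.

Definition triangle (O A B : pt) : set pt :=
  [set x | exists s t : R, [/\ 0 <= s, 0 <= t, s + t <= 1 &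
     x = (O.1 + s * (A.1 - O.1) + t * (B.1 - O.1),
          O.2 + s * (A.2 - O.2) + t * (B.2 - O.2))]].

Definition open_triangle (O A B : pt) : set pt :=
  [set x | exists s t : R, [/\ 0 < s, 0 < t, s + t < 1 &
     x = (O.1 + s * (A.1 - O.1) + t * (B.1 - O.1),
          O.2 + s * (A.2 - O.2) + t * (B.2 - O.2))]].

Definition segment (p q : pt) : set pt := [set lerp p q t | t in `[0, 1]%classic].

Definition convex_on (S : set pt) (f : pt -> R) : Prop :=
  forall x y t, S x -> S y -> 0 <= t <= 1 ->
    f (lerp x y t) <= (1 - t) * f x + t * f y.

(* A polygon with vertices A_0..A_{n-1} that is star-shaped with respect to O,
   O in its kernel: the fan triangles O A_k A_{k+1} (indices mod n) are
   nondegenerate, all of the same orientation, and have pairwise disjoint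
   interiors; the polygonal region is then the union of these triangles. *)
Definition nextI (n : nat) (k : 'I_n) : 'I_n :=
  @Ordinal n ((k.+1) %% n) (ltn_pmod _ (leq_ltn_trans (leq0n k) (ltn_ord k))).

Definition star_polygon (n : nat) (A : 'I_n -> pt) (O : pt) : Prop :=
  [/\ (3 <= n)%N,
      (forall k, 0 < det2 O (A k) (A (nextI k))) \/
      (forall k, det2 O (A k) (A (nextI k)) < 0) &
      forall k l, k != l ->
        open_triangle O (A k) (A (nextI k)) `&`
        open_triangle O (A l) (A (nextI l)) = set0].

Definition polygon_region (n : nat) (A : 'I_n -> pt) (O : pt) : set pt :=
  \bigcup_(k in [set: 'I_n]) triangle O (A k) (A (nextI k)).

Definition nice_polygon (n : nat) (A : 'I_n -> pt) (O : pt) : Prop :=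
  star_polygon A O /\
  forall k l, tri_area O (A k) (A (nextI k)) = tri_area O (A l) (A (nextI l)).

Definition leb2 := (@lebesgue_measure R \x @lebesgue_measure R)%E.

Definition avg_area (P : set pt) (f : pt -> R) : R :=
  (\int[leb2]_(x in P) f x) / fine (leb2 P).

(* average of f over the segment [p, q] with respect to length
   (arc-length parametrization, the length factor cancels) *)
Definition avg_seg (f : pt -> R) (p q : pt) : R :=
  \int[@lebesgue_measure R]_(t in `[0, 1]%classic) f (lerp p q t).

End Plane.

(* Main.v *)
Require Import Defs.
From HB Require Import structures.
From mathcomp Require Import all_boot all_order all_algebra.
From mathcomp Require Import all_classical all_reals all_analysis.
From mathcomp Require Import measurable_realfun ring lra.
Import Order.TTheory GRing.Theory Num.Theory.
Import numFieldNormedType.Exports.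
Local Open Scope classical_set_scope.
Local Open Scope ring_scope.

(* Let V be one of A_k, A_(k+1) and W the other one. The segments joining V to
   the points of OW sweep out the triangle O A_k A_(k+1), and convexity of f on
   each of them gives, after integration,
     Avg(f, O A_k A_(k+1)) <= f(V) / 3 + 2 / 3 * Avg(f, OW).
   Choosing for V the odd (resp. even) vertex of every triangle and averaging
   over the n triangles, which have equal areas, yields the two inequalities,
   since n is even and hence every vertex is chosen in exactly two triangles.
   The integral over a triangle is computed on the standard simplex through an
   affine change of variables. A finite convex function on a simplex is upper
   semicontinuous and bounded, hence measurable and integrable. *)

(** * Affine changes of variables *)

(** By uniqueness of Lebesgue measure: it agrees on half-open intervals with [|a|] times its image
    under [x => a * x + b]. *)
Lemma ge0_integral_affine {R : realType} (a b : R) (g : R -> \bar R) :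
  a != 0 -> measurable_fun setT g -> (forall x, (0 <= g x)%E) ->
  (\int[@lebesgue_measure R]_x g x =
   `|a|%:E * \int[@lebesgue_measure R]_x g (a * x + b)%R)%E.
Proof.
move=> a0 mg g0.
have mphi : measurable_fun setT ((fun x => a * x + b) : R -> measurableTypeR R).
  by apply: measurable_funD => //; exact: measurable_funM.
have ea (A : set (measurableTypeR R)) : measurable A -> A `<=` setT ->
    @lebesgue_measure R A =
    mscale (NngNum (normr_ge0 a)) (pushforward (@lebesgue_measure R)
      ((fun x => a * x + b) : R -> measurableTypeR R)) A.
  move=> mA _; apply: lebesgue_measure_unique => // _ [[x y]] _ <-.
  rewrite /= /mscale/= /pushforward.
  case: (ltgtP a 0) a0 => // a0 _.
  (* A negative slope reverses the interval, so the preimage of a right-closed interval is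
     left-closed. *)
  - rewrite (_ : _ @^-1` _ = `[(y - b) / a, (x - b) / a[%classic); last first.
      apply/seteqP; split => z /=; rewrite !in_itv/= ler_ndivrMr// ltr_ndivlMr//;
        by move=> /andP[? ?]; apply/andP; split; lra.
    rewrite !lebesgue_measure_itv/= !lte_fin ltr_nM2r ?invr_lt0// ltrD2r.
    case: ifP => xy; last by rewrite mule0.
    by rewrite -!EFinB -EFinM ltr0_norm//; congr (_%:E); field; rewrite lt_eqF.
  - rewrite (_ : _ @^-1` _ = `](x - b) / a, (y - b) / a]%classic); last first.
      apply/seteqP; split => z /=; rewrite !in_itv/= ler_pdivlMr// ltr_pdivrMr//;
        by move=> /andP[? ?]; apply/andP; split; lra.
    rewrite !lebesgue_measure_itv/= !lte_fin ltr_pM2r ?invr_gt0// ltrD2r.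
    case: ifP => xy; last by rewrite mule0.
    by rewrite -!EFinB -EFinM gtr0_norm//; congr (_%:E); field; rewrite gt_eqF.
rewrite (eq_measure_integral _ (ea mphi)) ge0_integral_mscale//=.
congr (_ * _)%E.
by rewrite ge0_integral_pushforward.
Qed.

(** The affine map that sends (0, 0), (1, 0), (0, 1) to [O], [A], [B]; its Jacobian determinant is
    [det2 O A B]. *)
Definition aff {R : realType} (O A B p : pt R) : pt R :=
  (O.1 + p.1 * (A.1 - O.1) + p.2 * (B.1 - O.1),
   O.2 + p.1 * (A.2 - O.2) + p.2 * (B.2 - O.2)).

Lemma measurable_aff {R : realType} (O A B : pt R) :
  measurable_fun setT (aff O A B).
Proof.
have m (c u v : R) : measurable_fun setT (fun p : R * R => c + p.1 * u + p.2 * v).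
  apply: measurable_funD; last by apply: measurable_funM => //; exact: measurable_snd.
  apply: measurable_funD => //.
  by apply: measurable_funM => //; exact: measurable_fst.
exact/measurable_fun_pair.
Qed.

Lemma leb2_integral_swap {R : realType} (h : pt R -> \bar R) :
  measurable_fun setT h -> (forall x, (0 <= h x)%E) ->
  (\int[@leb2 R]_p h p = \int[@leb2 R]_p h (p.2, p.1))%E.
Proof.
move=> mh h0; rewrite /leb2 fubini_tonelli1// [RHS]fubini_tonelli2//.
by apply: measurableT_comp => //; apply/measurable_fun_pair.
Qed.

(** Two one-dimensional substitutions: first [s] is traded for the abscissa [x] at fixed [t], then,
    after Tonelli, [t] for the ordinate at fixed [x]. Their Jacobians [A.1 - O.1] and
    [det2 O A B / (A.1 - O.1)] multiply to the determinant. *)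
Lemma ge0_integral_aff {R : realType} (O A B : pt R) (h : pt R -> \bar R) :
  det2 O A B != 0 -> measurable_fun setT h -> (forall x, (0 <= h x)%E) ->
  (\int[@leb2 R]_p h p =
   `|det2 O A B|%:E * \int[@leb2 R]_p h (aff O A B p))%E.
Proof.
move=> d0 mh h0.
(* If [A.1 = O.1], nondegeneracy forces [B.1 != O.1]; exchanging [A] and [B] only flips the sign of
   the determinant and swaps the two integration variables. *)
wlog a0 : A B d0 / A.1 - O.1 != 0.
  move=> H; have [a0|] := eqVneq (A.1 - O.1) 0; last exact: H.
  have dBA : det2 O B A = - det2 O A B by rewrite /det2; ring.
  have b0 : B.1 - O.1 != 0.
    by apply: contraNneq d0 => b0; rewrite /det2 a0 b0; apply/eqP; ring.
  rewrite (H B A) ?dBA ?oppr_eq0// normrN; congr (_ * _)%E.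
  rewrite leb2_integral_swap//; last by apply: measurableT_comp => //; exact: measurable_aff.
  by apply: eq_integral => p _; congr h; rewrite /aff/=; congr (_, _); ring.
have mhaff := measurableT_comp mh (measurable_aff O A B).
have -> : (\int[@leb2 R]_p h (aff O A B p) = \int[@lebesgue_measure R]_t
    \int[@lebesgue_measure R]_s h (aff O A B (s, t)))%E.
  exact: (fubini_tonelli2 (m1 := @lebesgue_measure R) (m2 := @lebesgue_measure R)
    (h \o aff O A B) mhaff (fun x => h0 _)).
set d := det2 O A B.
(* The ordinate of [aff O A B (s, t)], with [s] eliminated in favour of the abscissa [x]. *)
pose y x t := O.2 + (x - O.1) / (A.1 - O.1) * (A.2 - O.2) + d / (A.1 - O.1) * t.
have my : measurable_fun setT (fun p : R * R => (p.1, y p.1 p.2)).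
  apply/measurable_fun_pair => //; rewrite /y.
  apply: measurable_funD; last by apply: measurable_funM => //; exact: measurable_snd.
  apply: measurable_funD => //; apply: measurable_funM => //.
  by apply: measurable_funM => //; apply: measurable_funB => //; exact: measurable_fst.
have mhy := measurableT_comp mh my.
rewrite [X in (_ = _ * X)%E](_ : _ =
    \int[@lebesgue_measure R]_t (`|A.1 - O.1|^-1%:E *
       \int[@lebesgue_measure R]_x h (x, y x t)))%E; last first.
  apply: eq_integral => t _.
  rewrite (ge0_integral_affine (A.1 - O.1) (O.1 + t * (B.1 - O.1))
    (fun x => h (x, y x t)))//; last first.
    exact: (measurable_fun_pair1 _ mhy).
  rewrite muleA -EFinM mulVf ?normr_eq0// mul1e.
  apply: eq_integral => s _; congr h; rewrite /aff /y/= /d /det2.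
  congr (_, _); first by ring.
  by field.
have hy0 x : (0 <= (h \o (fun p : R * R => (p.1, y p.1 p.2))) x)%E by exact: h0.
have mF := measurable_fun_fubini_tonelli_F (m2 := @lebesgue_measure R) _ mhy hy0.
have mG := measurable_fun_fubini_tonelli_G (m1 := @lebesgue_measure R) _ mhy hy0.
rewrite ge0_integralZl//; last by move=> t _; exact: integral_ge0.
have -> := esym (fubini_tonelli (m1 := @lebesgue_measure R)
  (m2 := @lebesgue_measure R) _ mhy hy0).
have -> := fubini_tonelli1 (m1 := @lebesgue_measure R)
  (m2 := @lebesgue_measure R) _ mh h0.
rewrite muleA -EFinM -ge0_integralZl//; last by move=> t _; exact: integral_ge0.
apply: eq_integral => x _; rewrite /fubini_F.
rewrite (ge0_integral_affine (d / (A.1 - O.1))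
  (O.2 + (x - O.1) / (A.1 - O.1) * (A.2 - O.2)) (fun t => h (x, t)))//; first last.
- exact: (measurable_fun_pair2 _ mh).
- by rewrite mulf_neq0 ?invr_eq0.
rewrite normrM normfV; congr (_ * _)%E.
by apply: eq_integral => t _; congr (h (_, _)); rewrite /y addrC.
Qed.

(** * Convex functions on the standard simplex *)

Definition simplex {R : realType} : set (pt R) :=
  [set p | [/\ 0 <= p.1, 0 <= p.2 & p.1 + p.2 <= 1]].

Lemma measurable_simplex {R : realType} : measurable (@simplex R).
Proof.
have mf : measurable_fun [set: R * R] (fst : R * R -> R) by exact: measurable_fst.
have ms : measurable_fun [set: R * R] (snd : R * R -> R) by exact: measurable_snd.
have mfs := measurable_funD mf ms.
rewrite (_ : simplex = ([set: R * R] `&` fst @^-1` `[0, +oo[) `&`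
  (([set: R * R] `&` snd @^-1` `[0, +oo[) `&`
  ([set: R * R] `&` (fst \+ snd) @^-1` `]-oo, 1]))).
  by apply: measurableI; [exact: mf|apply: measurableI; [exact: ms|exact: mfs]].
apply/seteqP; split => p /=; rewrite !in_itv/= !andbT.
  by case.
by move=> [[_ ?] [[_ ?] [_ ?]]].
Qed.

Section convex_on_simplex.
Context {R : realType} (F : pt R -> R) (cF : convex_on simplex F).

Let M := `|F (0, 0)| + `|F (1, 0)| + `|F (0, 1)|.

(** Convexity is used twice: along the base from (0, 0) to (1, 0), then along the segment from a
    base point through [p] to the apex (0, 1). *)
Lemma convex_simplex_le p : simplex p -> F p <= M.
Proof.
move=> [p1 p2 p12].
have n0 := ler_norm (F (0, 0)); have n1 := ler_norm (F (1, 0)).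
have n2 := ler_norm (F (0, 1)).
have m0 := normr_ge0 (F (0, 0)); have m1 := normr_ge0 (F (1, 0)).
have m2 := normr_ge0 (F (0, 1)).
have base x : 0 <= x <= 1 -> F (x, 0) <= M.
  move=> x01; have -> : (x, 0) = lerp (0, 0) (1, 0) x.
    by rewrite /lerp/=; congr (_, _); ring.
  apply: le_trans (cF _ _ _ _ _ x01) _; first by split => //=; lra.
    by split => //=; lra.
  by rewrite /M; nra.
(* The apex is treated apart, since projecting [p] from it onto the base divides by [1 - p.2]. *)
have [p21|p21] := eqVneq p.2 1.
  have -> : p = (0, 1) by rewrite [p]surjective_pairing p21; congr (_, _); lra.
  by rewrite /M; lra.
have c0 : 0 < 1 - p.2 by rewrite subr_gt0 lt_neqAle p21/=; lra.
have p0 : 0 <= p.1 / (1 - p.2) <= 1.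
  by apply/andP; split; [rewrite divr_ge0// ltW|rewrite ler_pdivrMr// mul1r; lra].
have -> : p = lerp (p.1 / (1 - p.2), 0) (0, 1) p.2.
  rewrite [LHS]surjective_pairing /lerp/=; congr (_, _); last by ring.
  by field; rewrite gt_eqF.
have p201 : 0 <= p.2 <= 1 by apply/andP; split => //; lra.
apply: le_trans (cF _ _ _ _ _ p201) _; [|by split => //=; lra|].
  by move: p0 => /andP[? ?]; split => //=; lra.
have hv : F (0, 1) <= M by rewrite /M; lra.
have hu := base _ p0.
move: p201 hu hv; set u := F _; set v := F (0, 1) => /andP[? ?] ? ?; nra.
Qed.

(** The centroid equals [2/3 y + 1/3 p], where [y] is the image of [p] under the homothety of ratio
    -1/2 about the centroid and stays in the simplex. The upper bound at [y] thus becomes a lower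
    bound at [p]. *)
Lemma convex_simplex_ge p : simplex p -> 3 * F (1 / 3, 1 / 3) - 2 * M <= F p.
Proof.
move=> Sp; have [p1 p2 p12] := Sp.
pose y : pt R := ((1 - p.1) / 2, (1 - p.2) / 2).
have Sy : simplex y by split; rewrite /y/=; lra.
have t01 : 0 <= (1 / 3 : R) <= 1 by apply/andP; split; lra.
have := cF _ _ _ Sy Sp t01.
have -> : lerp y p (1 / 3) = (1 / 3, 1 / 3).
  by rewrite /lerp /y/=; congr (_, _); field.
have := convex_simplex_le _ Sy; lra.
Qed.

(* [y = (1 - e) x + e z] with [z] still in the simplex as soon as [y] is close
   enough to [x]: a vanishing barycentric coordinate of [x] can only increase. *)
Lemma convex_simplex_usc x c : simplex x -> F x < c ->
  exists2 d, 0 < d & forall y, simplex y ->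
    `|y.1 - x.1| < d -> `|y.2 - x.2| < d -> F y < c.
Proof.
move=> Sx Fc; have [x1 x2 x12] := Sx.
pose K := `|M - F x|; have K0 : 0 <= K := normr_ge0 _.
(* Small enough for [e * K < c - F x], so that [(1 - e) F x + e F z <= F x + e K < c] whenever
   [F z <= M]. *)
pose e := (c - F x) / (c - F x + K + 1).
have D0 : 0 < c - F x + K + 1 by lra.
have e0 : 0 < e by rewrite divr_gt0// subr_gt0.
have e1 : e <= 1 by rewrite ler_pdivrMr//; lra.
have eK : e * K < c - F x.
  have -> : c - F x = e * (c - F x + K + 1) by rewrite /e divfK// gt_eqF.
  by rewrite ltr_pM2l//; lra.
(* Admissible displacement for a barycentric coordinate [l] of [x]; for [l = 0] any positive value
   will do. *)
pose g l : R := if 0 < l then e * l / 2 else 1.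
have g0 l : 0 < g l by rewrite /g; case: ifP => // l0; rewrite divr_gt0// mulr_gt0.
(* The bound is [2 * d] because the third coordinate [1 - x.1 - x.2] moves by the sum of two
   displacements. *)
have gP l m d : 0 <= l -> 0 <= m -> - (2 * d) <= m - l -> d <= g l ->
    0 <= l + (m - l) / e.
  move=> l0 m0 ml dl; rewrite -(pmulr_rge0 _ e0) mulrDr mulrCA divff ?gt_eqF// mulr1.
  move: dl; rewrite /g; case: ifP => [l1|/negbT]; first by nra.
  by rewrite -leNgt => l2 _; nra.
exists (Num.min (g x.1) (Num.min (g x.2) (g (1 - x.1 - x.2)))).
  by rewrite !lt_min !g0.
move=> y Sy; have [y1 y2 y12] := Sy; rewrite !lt_min !ltr_norml.
move=> /and3P[/andP[a1 _] /andP[a2 _] /andP[a3 a3']].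
move=> /and3P[/andP[b1 _] /andP[b2 _] /andP[b3 b3']].
pose z : pt R := (x.1 + (y.1 - x.1) / e, x.2 + (y.2 - x.2) / e).
have Sz : simplex z.
  split; rewrite /z/=.
  - by apply: (gP _ _ (g x.1)) => //; have := g0 x.1; lra.
  - by apply: (gP _ _ (g x.2)) => //; have := g0 x.2; lra.
  - suff : 0 <= (1 - x.1 - x.2) + ((1 - y.1 - y.2) - (1 - x.1 - x.2)) / e.
      have -> : (1 - y.1 - y.2 - (1 - x.1 - x.2)) / e =
        - ((y.1 - x.1) / e) - (y.2 - x.2) / e by field; rewrite gt_eqF.
      lra.
    apply: (gP _ _ (g (1 - x.1 - x.2))) => //; lra.
have e01 : 0 <= e <= 1 by rewrite e1 ltW.
have -> : y = lerp x z e.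
  by rewrite [LHS]surjective_pairing /lerp /z/=; congr (_, _); field; rewrite gt_eqF.
apply: le_lt_trans (cF _ _ _ Sx Sz e01) _.
have Fz := convex_simplex_le _ Sz.
have kM : M - F x <= K := ler_norm _.
by nra.
Qed.

(** By upper semicontinuity, each set [F < c] is the trace on the simplex of a union of open
    rectangles with rational ends, of which there are countably many. *)
Lemma measurable_convex_simplex : measurable_fun simplex F.
Proof.
apply: (measurability (@RGenInftyO.G R)); first exact: RGenInftyO.measurableE.
move=> _ [_ [c ->] <-].
pose Q (q : rat * rat * (rat * rat)) : set (R * R) :=
  (`]ratr q.1.1, ratr q.1.2[ `*` `]ratr q.2.1, ratr q.2.2[)%classic.
pose G q := if `[< Q q `&` simplex `<=` [set p | F p < c] >] then Q q else set0.
rewrite (_ : _ `&` _ = simplex `&` \bigcup_(q in setT) G q).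
  apply: measurableI; first exact: measurable_simplex.
  apply: countable_bigcupT_measurable => [|q]; first exact: countableP.
  by rewrite /G; case: ifP => // _; apply: measurableX; exact: measurable_itv.
apply/seteqP; split => [x [Sx]|x [Sx [q _]]]; last first.
  rewrite /G; case: ifPn => // /asboolP sub Qx; split => //=.
  by rewrite in_itv/=; exact: sub.
rewrite /= in_itv/= => Fc; split => //.
have [d d0 dP] := convex_simplex_usc _ _ Sx Fc.
have lo a : exists q, a - d < ratr q < a.
  have /rat_in_itvoo[q] : a - d < a; first by lra.
  by rewrite in_itv/=; exists q.
have hi a : exists q, a < ratr q < a + d.
  have /rat_in_itvoo[q] : a < a + d; first by lra.
  by rewrite in_itv/=; exists q.
have [q1 /andP[q1l q1h]] := lo x.1; have [q2 /andP[q2l q2h]] := hi x.1.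
have [q3 /andP[q3l q3h]] := lo x.2; have [q4 /andP[q4l q4h]] := hi x.2.
exists (q1, q2, (q3, q4)) => //; rewrite /G ifT.
  by rewrite /Q/=; split; rewrite /= in_itv/=; apply/andP.
apply/asboolP => y [[/=]]; rewrite !in_itv/= => /andP[? ?] /andP[? ?] Sy.
by apply: dP => //; rewrite ltr_norml; apply/andP; split; lra.
Qed.

End convex_on_simplex.

(** Lets [leb2] carry the measure structure of the product that it unfolds to. *)
HB.instance Definition _ (R : realType) :=
  Measure.copy (@leb2 R) (@lebesgue_measure R \x @lebesgue_measure R)%E.

(** * Integrals over the standard simplex *)

Section simplex_integral.
Context {R : realType}.
Notation mu := (@lebesgue_measure R).
Notation I01 := (`[0, 1]%classic : set R).

Let mI : measurable (I01 : set (measurableTypeR R)).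
Proof. exact: measurable_itv. Qed.

Let mS : measurable (simplex : set (measurableTypeR R * measurableTypeR R)).
Proof. exact: measurable_simplex. Qed.

Lemma integrable_onemXn n : mu.-integrable I01 (EFin \o (fun t : R => (1 - t) ^+ n)).
Proof.
apply: continuous_compact_integrable; first exact: segment_compact.
by apply: continuous_in_subspaceT => x _; exact: continuous_onemXn.
Qed.

(** Serves for the area of the simplex ([a = 1], [b = 0]) and for the weights 1/6 and 1/3 below
    ([a = u], [b = v - u]). *)
Lemma Rintegral_onem12 (a b : R) :
  \int[mu]_(t in I01) ((1 - t) * a + (1 - t) ^+ 2 * b) = a / 2 + b / 3.
Proof.
have i1 := integrable_onemXn 1; have i2 := integrable_onemXn 2.
rewrite RintegralD//.
- rewrite !RintegralZr//.
  have /= -> := @Rintegral_onemXn R 1; have /= -> := @Rintegral_onemXn R 2.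
  by rewrite mulrC [in X in _ + X = _]mulrC.
- exact: (integrableZr mI a i1).
- exact: (integrableZr mI b i2).
Qed.

Lemma integrable_onem12 (a b : R) :
  mu.-integrable I01 (EFin \o (fun t => (1 - t) * a + (1 - t) ^+ 2 * b)).
Proof.
have i1 := integrable_onemXn 1; have i2 := integrable_onemXn 2.
exact: (integrableD mI (integrableZr mI a i1)
  (integrableZr mI b i2)).
Qed.

Lemma leb2_simplex : @leb2 R simplex = (1 / 2)%:E.
Proof.
have -> : @leb2 R simplex = (\int[mu]_x mu (xsection simplex x))%E by [].
transitivity (\int[mu]_(x in I01) ((1 - x) * 1 + (1 - x) ^+ 2 * 0)%:E)%E.
  rewrite [RHS]integral_mkcond; apply: eq_integral => x _.
  rewrite patchE; case: ifPn => [|].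
    rewrite inE/= in_itv/= => /andP[x0 x1].
    rewrite (_ : xsection _ _ = `[0, 1 - x]%classic); last first.
      apply/seteqP; split => y; rewrite /xsection/= inE/= /simplex/= in_itv/=.
        by move=> [/= ? ? ?]; apply/andP; split; lra.
      by move=> /andP[? ?]; split => //=; lra.
    rewrite lebesgue_measure_itv/= lte_fin; case: ifPn => [_|].
      by rewrite -EFinB; congr (_%:E); ring.
    by rewrite -leNgt => x1'; congr (_%:E); nra.
  move=> xI; rewrite (_ : xsection _ _ = set0) ?measure0//.
  apply/seteqP; split => y//; rewrite /xsection/= inE/= /simplex/=.
  move=> [/= ? ? ?]; move/negP : xI; apply.
  by rewrite inE/= in_itv/=; apply/andP; split; lra.
have := Rintegral_onem12 1 0; rewrite /Rintegral => E.
rewrite -[LHS]fineK; last exact: (integrable_fin_num mI (integrable_onem12 _ _)).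
by rewrite E; congr (_%:E); ring.
Qed.

Section convex.
Context (F : pt R -> R) (cF : convex_on simplex F).

Lemma bounded_convex_simplex : [bounded F p | p in simplex].
Proof.
exists (`|3 * F (1 / 3, 1 / 3) - 2 * (`|F (0, 0)| + `|F (1, 0)| + `|F (0, 1)|)|
  + (`|F (0, 0)| + `|F (1, 0)| + `|F (0, 1)|)).
split; first exact: num_real.
move=> x hx p Sp; apply/ltW/(le_lt_trans _ hx).
have := convex_simplex_ge _ cF _ Sp; have := convex_simplex_le _ cF _ Sp.
set M := `|_| + _ + _; have M0 : 0 <= M by rewrite !addr_ge0.
set L := _ - _; have := ler_norm (- L); rewrite normrN.
have := normr_ge0 L.
by move=> ? ? ? ?; rewrite ler_norml; apply/andP; split; lra.
Qed.

Lemma integrable_convex_simplex : (@leb2 R).-integrable simplex (EFin \o F).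
Proof.
apply: measurable_bounded_integrable.
- exact: measurable_simplex.
- by rewrite /= leb2_simplex ltry.
- exact: measurable_convex_simplex.
- exact: bounded_convex_simplex.
Qed.

Lemma measurable_convex_edge : measurable_fun I01 (fun t => F (t, 0)).
Proof.
apply: (@measurable_comp _ _ _ _ _ _ simplex F I01 (fun t : R => (t, 0))).
- exact: measurable_simplex.
- move=> _ [t + <-]; rewrite /= in_itv/= => /andP[? ?].
  by split => /=; lra.
- exact: measurable_convex_simplex.
- exact/measurable_funTS/pair2_measurable.
Qed.

Lemma integrable_convex_edge : mu.-integrable I01 (EFin \o (fun t => F (t, 0))).
Proof.
apply: measurable_bounded_integrable => //.
- by rewrite /= lebesgue_measure_itv/= lte_fin ltr01 -EFinB ltry.
- exact: measurable_convex_edge.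
- have [K [Kr KP]] := bounded_convex_simplex.
  exists K; split => // x hx t/=; rewrite in_itv/= => /andP[? ?].
  by apply: KP => //; split => /=; lra.
Qed.

(* On the horizontal section at height [b] substitute [x = (1 - b) t] and use
   [((1 - b) t, b) = (1 - b) (t, 0) + b (0, 1)]. *)
Lemma ge0_integral_convex_simplex : (forall p, simplex p -> 0 <= F p) ->
  \int[@leb2 R]_(p in simplex) F p <=
  F (0, 1) / 6 + (\int[mu]_(t in I01) F (t, 0)) / 3.
Proof.
move=> F0; set u := F (0, 1); set v := \int[mu]_(t in _) _.
have i2 := integrable_convex_simplex.
have i1 := integrable_convex_edge.
pose g := (EFin \o F) \_ simplex.
have mg : measurable_fun setT g.
  apply/(measurable_restrictT _ measurable_simplex).
  by apply: measurableT_comp => //; exact: measurable_convex_simplex.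
have g0 p : (0 <= g p)%E by apply: erestrict_ge0 => q Sq; rewrite lee_fin F0.
(* The integrand is [(1 - b) * (b u + (1 - b) v)]: the length of the section at height [b] times the
   bound for the mean of [F] on it. *)
have -> : u / 6 + v / 3 = fine (\int[mu]_(b in I01)
    ((1 - b) * u + (1 - b) ^+ 2 * (v - u))%:E)%E.
  by have := Rintegral_onem12 u (v - u); rewrite /Rintegral => ->; field.
rewrite /Rintegral; apply: fine_le.
- exact: (integrable_fin_num mS i2).
- exact: (integrable_fin_num mI (integrable_onem12 _ _)).
rewrite integral_mkcond [leRHS]integral_mkcond.
have -> := fubini_tonelli2 (m1 := mu) (m2 := mu) _ mg g0.
apply: ge0_le_integral => //.
- by move=> b _; exact: integral_ge0.
- exact: (measurable_fun_fubini_tonelli_G (m1 := mu) _ mg g0).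
- apply/(measurable_restrictT _ (measurable_itv _)).
  exact: measurable_int (integrable_onem12 _ _).
move=> b _; rewrite /fubini_G patchE; case: ifPn => [|bI]; last first.
  rewrite integral0_eq// => x _; rewrite /g patchE ifF//.
  apply/negP; rewrite inE => -[/= ? ? ?]; move/negP : bI; apply.
  by rewrite inE/= in_itv/=; apply/andP; split; lra.
rewrite inE/= in_itv/= => /andP[b0 b1].
(* At the apex the section is a single point and the substitution degenerates. *)
have [b1'|b1'] := eqVneq b 1.
  rewrite (_ : (fun x => _) = ((fun x => (F (x, b))%:E) \_ [set 0])); last first.
    apply/funext => x; rewrite /g !patchE; congr (if _ then _ else _).
    apply/idP/idP; rewrite !inE/= b1'; first by move=> [/= ? ? ?]; lra.
    by move=> ->; split => /=; lra.
  rewrite -integral_mkcond integral_set1 lee_fin b1'; lra.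
have c0 : 0 < 1 - b by rewrite subr_gt0 lt_neqAle b1'.
rewrite (ge0_integral_affine (1 - b) 0)//; last 2 first.
- by rewrite gt_eqF.
- exact: (measurable_fun_pair1 _ mg).
rewrite gtr0_norm//.
have -> : ((1 - b) * u + (1 - b) ^+ 2 * (v - u))%:E =
   ((1 - b)%:E * (b * u + (1 - b) * v)%:E)%E by rewrite -EFinM; congr (_%:E); ring.
apply: lee_wpmul2l; first by rewrite lee_fin ltW.
(* Written as an integral over [t], the bound can be compared pointwise with the substituted
   section. *)
have -> : (b * u + (1 - b) * v)%:E = (\int[mu]_(t in I01) (b * u + (1 - b) * F (t, 0))%:E)%E.
  have ic : mu.-integrable I01 (EFin \o (fun=> b * u)).
    apply: continuous_compact_integrable; first exact: segment_compact.
    by apply: continuous_in_subspaceT => x _; exact: cst_continuous.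
  have iz : mu.-integrable I01 (EFin \o (fun t => (1 - b) * F (t, 0))).
    exact: (integrableZl mI (1 - b) i1).
  rewrite -[RHS]fineK; last exact: (integrable_fin_num mI (integrableD mI ic iz)).
  have := RintegralD mI ic iz; rewrite {1}/Rintegral => ->//.
  rewrite Rintegral_cst// RintegralZl//= lebesgue_measure_itv/= lte_fin ltr01.
  by rewrite -EFinB/= subr0 mulr1.
rewrite [leRHS]integral_mkcond.
apply: ge0_le_integral => //.
- have mab : measurable_fun setT (fun t : R => ((1 - b) * t + 0, b)).
    by apply/measurable_fun_pair => //; apply: measurable_funD => //;
      exact: measurable_funM.
  exact: (measurableT_comp mg mab).
- apply/(measurable_restrictT _ (measurable_itv _)); apply: measurableT_comp => //.
  apply: measurable_funD => //; apply: measurable_funM => //.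
  exact: measurable_convex_edge.
move=> t _; rewrite /g !patchE addr0.
case: ifPn => [|St].
  rewrite inE => -[/= s1 s2 s3].
  have t01 : 0 <= t <= 1.
    apply/andP; split; first by move: s1; rewrite pmulr_rge0.
    by rewrite -(ler_pM2l c0); lra.
  rewrite ifT; last by rewrite inE/= in_itv.
  rewrite lee_fin; have -> : ((1 - b) * t, b) = lerp (t, 0) (0, 1) b.
    by rewrite /lerp/=; congr (_, _); ring.
  rewrite [leRHS]addrC; apply: cF; last by rewrite b0.
  - by move: t01 => /andP[? ?]; split => /=; lra.
  - by split => /=; lra.
(* Off the simplex the left integrand is 0, so nonnegativity of [F] suffices. *)
case: ifPn => // tI; rewrite lee_fin.
move: tI; rewrite inE/= in_itv/= => /andP[t0 t1].
have u0 : 0 <= u by apply: F0; split => /=; lra.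
have Ft : 0 <= F (t, 0) by apply: F0; split => /=; lra.
by rewrite addr_ge0// mulr_ge0// ltW.
Qed.

End convex.
End simplex_integral.

(** Subtracting the lower bound [L] reduces to the nonnegative case; both sides drop by [L / 2], as
    the area is 1/2 and [1/6 + 1/3 = 1/2]. *)
Lemma integral_convex_simplex {R : realType} (F : pt R -> R) :
  convex_on simplex F ->
  \int[@leb2 R]_(p in simplex) F p <=
  F (0, 1) / 6 + (\int[@lebesgue_measure R]_(t in `[0, 1]%classic) F (t, 0)) / 3.
Proof.
move=> cF.
have mI : measurable (`[0, 1]%classic : set (measurableTypeR R)) by exact: measurable_itv.
have mS : measurable (simplex : set (measurableTypeR R * measurableTypeR R)).
  exact: measurable_simplex.
set L := 3 * F (1 / 3, 1 / 3) - 2 * (`|F (0, 0)| + `|F (1, 0)| + `|F (0, 1)|).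
have cG : convex_on simplex (fun p => F p - L).
  move=> x y t Sx Sy t01; have := cF x y t Sx Sy t01; lra.
have G0 p : simplex p -> 0 <= F p - L.
  by move=> Sp; rewrite subr_ge0; exact: convex_simplex_ge.
have cL : convex_on simplex (fun=> L) by move=> x y t Sx Sy t01; lra.
have := ge0_integral_convex_simplex _ cG G0.
rewrite (RintegralB mS (integrable_convex_simplex _ cF) (integrable_convex_simplex _ cL)).
rewrite (RintegralB mI (integrable_convex_edge _ cF) (integrable_convex_edge _ cL)).
rewrite !Rintegral_cst//= leb2_simplex lebesgue_measure_itv/= lte_fin ltr01/=.
lra.
Qed.

(** * The boundary of the standard simplex *)

Section open_simplex.
Context {R : realType}.

Definition open_simplex : set (pt R) :=
  [set p | [/\ 0 < p.1, 0 < p.2 & p.1 + p.2 < 1]].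

Lemma measurable_open_simplex : measurable open_simplex.
Proof.
have mf : measurable_fun [set: R * R] (fst : R * R -> R) by exact: measurable_fst.
have ms : measurable_fun [set: R * R] (snd : R * R -> R) by exact: measurable_snd.
have mfs := measurable_funD mf ms.
rewrite (_ : open_simplex = ([set: R * R] `&` fst @^-1` `]0, +oo[) `&`
  (([set: R * R] `&` snd @^-1` `]0, +oo[) `&`
  ([set: R * R] `&` (fst \+ snd) @^-1` `]-oo, 1[))).
  by apply: measurableI; [exact: mf|apply: measurableI; [exact: ms|exact: mfs]].
apply/seteqP; split => p /=; rewrite !in_itv/= !andbT.
  by case.
by move=> [[_ ?] [[_ ?] [_ ?]]].
Qed.

(** For [x != 0] the vertical section of the boundary lies in the finite set of 0 and [1 - x]; the
    remaining abscissa 0 is a null set. *)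
Lemma leb2_simplex_boundary : @leb2 R (simplex `\` open_simplex) = 0%E.
Proof.
have mSS : measurable (simplex `\` open_simplex : set (measurableTypeR R * measurableTypeR R)).
  by apply: measurableD; [exact: measurable_simplex|exact: measurable_open_simplex].
have -> : @leb2 R (simplex `\` open_simplex) =
  (\int[@lebesgue_measure R]_x @lebesgue_measure R (xsection (simplex `\` open_simplex) x))%E by [].
rewrite (_ : (fun x => _) = (fun x => @lebesgue_measure R
  (xsection (simplex `\` open_simplex) x)) \_ [set 0]).
  by rewrite -integral_mkcond integral_set1.
apply/funext => x; rewrite patchE; case: ifPn => // x0.
have {}x0 : x != 0 by apply: contra x0 => /eqP ->; rewrite inE.
apply: countable_lebesgue_measure0; apply/finite_set_countable.
apply: (@sub_finite_set _ _ [set 0; 1 - x]); last exact: finite_set2.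
move=> y; rewrite /xsection/= inE => -[[/= x1 y1 xy] no].
have [->|y0] := eqVneq y 0; first by left.
right; apply: contrapT => yx; apply: no; split => /=.
- by rewrite lt_neqAle eq_sym x0.
- by rewrite lt_neqAle eq_sym y0.
- by rewrite lt_neqAle xy andbT; apply/eqP => xy1; apply: yx; rewrite -xy1; ring.
Qed.

End open_simplex.

(** * Triangles *)

Section triangle.
Context {R : realType} (O A B : pt R) (d0 : det2 O A B != 0).

(** The inverse of [aff O A B], by Cramer's rule. *)
Definition barycentric (x : pt R) : pt R :=
  (det2 O x B / det2 O A B, det2 O A x / det2 O A B).

Lemma barycentricK : cancel barycentric (aff O A B).
Proof.
move=> x; rewrite [RHS]surjective_pairing /aff /barycentric/=.
by move: d0; rewrite /det2 => ?; congr (_, _); field.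
Qed.

Lemma affK : cancel (aff O A B) barycentric.
Proof.
move=> x; rewrite [RHS]surjective_pairing /aff /barycentric/=.
by move: d0; rewrite /det2/= => ?; congr (_, _); field.
Qed.

Lemma aff_lerp p q t : aff O A B (lerp p q t) = lerp (aff O A B p) (aff O A B q) t.
Proof. by rewrite /aff /lerp/=; congr (_, _); ring. Qed.

Lemma triangleE : triangle O A B = barycentric @^-1` simplex.
Proof.
apply/seteqP; split=> [x [s [t [s0 t0 st ->]]]|x [/= s0 t0 st]].
  by rewrite /preimage/= -[X in barycentric X]/(aff O A B (s, t)) affK.
by exists (barycentric x).1, (barycentric x).2; split=> //; rewrite -{1}[x]barycentricK.
Qed.

Lemma open_triangleE : open_triangle O A B = barycentric @^-1` open_simplex.
Proof.
apply/seteqP; split=> [x [s [t [s0 t0 st ->]]]|x [/= s0 t0 st]].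
  by rewrite /preimage/= -[X in barycentric X]/(aff O A B (s, t)) affK.
by exists (barycentric x).1, (barycentric x).2; split=> //; rewrite -{1}[x]barycentricK.
Qed.

Lemma measurable_barycentric : measurable_fun setT barycentric.
Proof.
have mf : measurable_fun [set: R * R] (fst : R * R -> R) by exact: measurable_fst.
have ms : measurable_fun [set: R * R] (snd : R * R -> R) by exact: measurable_snd.
by apply/measurable_fun_pair; apply: measurable_funM => //; apply: measurable_funB;
  apply: measurable_funM => //; apply: measurable_funB.
Qed.

Lemma measurable_triangle :
  measurable (triangle O A B : set (measurableTypeR R * measurableTypeR R)).
Proof.
rewrite triangleE -[X in measurable X]setTI.
exact: (measurable_barycentric measurableT _ measurable_simplex).
Qed.

Lemma measurable_open_triangle :
  measurable (open_triangle O A B : set (measurableTypeR R * measurableTypeR R)).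
Proof.
rewrite open_triangleE -[X in measurable X]setTI.
exact: (measurable_barycentric measurableT _ measurable_open_simplex).
Qed.

Lemma leb2_aff (E : set (measurableTypeR R * measurableTypeR R)) : measurable E ->
  @leb2 R E = (`|det2 O A B|%:E * @leb2 R (aff O A B @^-1` E))%E.
Proof.
move=> mE.
have mE' : measurable (aff O A B @^-1` E : set (measurableTypeR R * measurableTypeR R)).
  rewrite -[X in measurable X]setTI.
  exact: (measurable_aff O A B measurableT _ mE).
rewrite -[in LHS](setIT E) -[in RHS](setIT (_ @^-1` _)).
rewrite -(integral_indic _ measurableT) -?(integral_indic _ measurableT)//.
rewrite (ge0_integral_aff O A B)//.
by apply: measurableT_comp => //; exact: measurable_indic.
Qed.

Lemma leb2_triangle : @leb2 R (triangle O A B) = (`|det2 O A B| / 2)%:E.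
Proof.
rewrite leb2_aff; last exact: measurable_triangle.
rewrite triangleE (_ : _ @^-1` _ = simplex).
  by rewrite leb2_simplex -EFinM mul1r.
by apply/seteqP; split => p; rewrite /preimage/= affK.
Qed.

Lemma leb2_triangle_boundary : @leb2 R (triangle O A B `\` open_triangle O A B) = 0%E.
Proof.
rewrite leb2_aff; last first.
  by apply: measurableD; [exact: measurable_triangle|exact: measurable_open_triangle].
rewrite triangleE open_triangleE (_ : _ @^-1` _ = simplex `\` open_simplex).
  by rewrite leb2_simplex_boundary mule0.
by apply/seteqP; split => p; rewrite /preimage/= affK.
Qed.

Context (f : pt R -> R) (cf : convex_on (triangle O A B) f).

Lemma convex_aff : convex_on simplex (f \o aff O A B).
Proof.
move=> p q t Sp Sq t01; rewrite /= aff_lerp; apply: cf => //;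
  by rewrite triangleE/preimage/= affK.
Qed.

Lemma measurable_convex_triangle : measurable_fun (triangle O A B) f.
Proof.
rewrite (_ : f = (f \o aff O A B) \o barycentric); last first.
  by apply/funext => x /=; rewrite barycentricK.
apply: (@measurable_comp _ _ _ _ _ _ simplex).
- exact: measurable_simplex.
- by rewrite triangleE => _ [x Sx <-].
- exact: (measurable_convex_simplex _ convex_aff).
- by apply: measurable_funTS; exact: measurable_barycentric.
Qed.

Lemma bounded_convex_triangle : [bounded f x | x in triangle O A B].
Proof.
have [K [Kr KP]] := bounded_convex_simplex _ convex_aff.
exists K; split => // x hx y; rewrite triangleE => Sy.
by have /= := KP x hx _ Sy; rewrite barycentricK.
Qed.

(** The change of variables for nonnegative functions is applied to the positive and negative parts,
    whose integrals are finite by integrability on the simplex. *)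
Lemma Rintegral_aff : \int[@leb2 R]_(x in triangle O A B) f x =
  `|det2 O A B| * \int[@leb2 R]_(p in simplex) f (aff O A B p).
Proof.
have mS : measurable (simplex : set (measurableTypeR R * measurableTypeR R)).
  exact: measurable_simplex.
have iF := integrable_convex_simplex _ convex_aff.
pose g := (EFin \o f) \_ (triangle O A B).
pose G := (EFin \o (f \o aff O A B)) \_ simplex.
have mg : measurable_fun setT g.
  apply/(measurable_restrictT _ measurable_triangle).
  by apply: measurableT_comp => //; exact: measurable_convex_triangle.
have gG : g \o aff O A B = G.
  apply/funext => p; rewrite /g /G/= !patchE triangleE.
  by congr (if _ then _ else _); apply/idP/idP; rewrite !inE/preimage/= affK.
have iG : (@leb2 R).-integrable setT G.
  by apply/(integrable_mkcond _ mS).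
rewrite /Rintegral integral_mkcond -/g [in RHS]integral_mkcond -/G.
rewrite integralE [in RHS]integralE.
rewrite (ge0_integral_aff O A B g^\+%E)//; last exact: (measurable_funepos mg).
rewrite (ge0_integral_aff O A B g^\-%E)//; last exact: (measurable_funeneg mg).
rewrite (_ : (fun p => g^\+ (aff O A B p))%E = G^\+%E); last first.
  by apply/funext => p; rewrite -gG !funeposE.
rewrite (_ : (fun p => g^\- (aff O A B p))%E = G^\-%E); last first.
  by apply/funext => p; rewrite -gG !funenegE.
rewrite -(fineK (integrable_pos_fin_num measurableT iG)).
rewrite -(fineK (integrable_neg_fin_num measurableT iG)).
by rewrite /= mulrBr.
Qed.

(** Here [B] is the vertex [V] and [A] is [W]: [aff O A B] sends (0, 1) to [B] and the base to [OA].
    As [|det2|] is twice the area, 1/6 and 1/3 become the weights 1/3 and 2/3 of the average. *)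
Lemma integral_convex_triangle : \int[@leb2 R]_(x in triangle O A B) f x <=
  `|det2 O A B| * (f B / 6 + avg_seg f O A / 3).
Proof.
rewrite Rintegral_aff ler_wpM2l//.
have := integral_convex_simplex _ convex_aff.
have -> : (f \o aff O A B) (0, 1) = f B.
  by rewrite [in RHS](surjective_pairing B) /=/aff/=; congr (f (_, _)); ring.
suff -> : \int[@lebesgue_measure R]_(t in `[0, 1]%classic) (f \o aff O A B) (t, 0) =
  avg_seg f O A by [].
rewrite /avg_seg; apply: eq_Rintegral => t _ /=.
by rewrite /aff /lerp/=; congr (f (_, _)); ring.
Qed.

End triangle.

(** * Finite unions with negligible overlaps *)

Section finite_union.
Context {d} {T : measurableType d} {R : realType}
  (mu : {measure set T -> \bar R}) {I : finType} (F : I -> set T).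
Context (mF : forall i, measurable (F i)).

Lemma measurable_bigcup_fin : measurable (\bigcup_i F i).
Proof. exact: fin_bigcup_measurable. Qed.

Lemma bigcup_finE : \bigcup_i F i = \big[setU/set0]_(i <- index_enum I) F i.
Proof.
rewrite -bigcup_seq; apply: eq_bigcupl; split => i //= _.
exact: mem_index_enum.
Qed.

Lemma bigcup_fin_lty : (forall i, mu (F i) < +oo)%E -> (mu (\bigcup_i F i) < +oo)%E.
Proof.
move=> Foo; rewrite bigcup_finE.
suff [] : measurable (\big[setU/set0]_(i <- index_enum I) F i) /\
  (mu (\big[setU/set0]_(i <- index_enum I) F i) < +oo)%E by [].
apply: (big_ind (fun A => measurable A /\ (mu A < +oo)%E)) => //.
- by rewrite measure0.
- move=> A B [mA Aoo] [mB Boo]; split; first exact: measurableU.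
  by apply: le_lt_trans (measureU2 _ mA mB) _; exact: lte_add_pinfty.
Qed.

Lemma bigcup_fin_null : (forall i, mu (F i) = 0)%E -> (mu (\bigcup_i F i) = 0)%E.
Proof.
move=> F0; rewrite bigcup_finE.
suff [] : measurable (\big[setU/set0]_(i <- index_enum I) F i) /\
  (mu (\big[setU/set0]_(i <- index_enum I) F i) = 0)%E by [].
apply: (big_ind (fun A => measurable A /\ (mu A = 0)%E)) => //.
move=> A B [mA A0] [mB B0]; split; first exact: measurableU.
by rewrite measureU0.
Qed.

Lemma measurable_fun_bigcup_fin {d'} {T' : measurableType d'} (f : T -> T') :
  (forall i, measurable_fun (F i) f) -> measurable_fun (\bigcup_i F i) f.
Proof.
move=> mf _ Y mY; rewrite setI_bigcupl; apply: fin_bigcup_measurable => //.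
by move=> i _; exact: mf.
Qed.

Lemma bounded_bigcup_fin (f : T -> R) :
  (forall i, [bounded f x | x in F i]) -> [bounded f x | x in \bigcup_i F i].
Proof.
move=> bf.
have : \forall K \near +oo, forall i x, F i x -> `|f x| <= K.
  by apply: filter_forall => i; exact: bf.
by apply: filterS => K FK x [i _ Fx]; exact: FK Fx.
Qed.

(** Removing the null set [N] makes the pieces disjoint and changes none of the integrals. *)
Lemma Rintegral_bigcup_fin (N : set T) (f : T -> R) :
  measurable N -> mu N = 0%E -> trivIset setT (fun i => F i `\` N) ->
  mu.-integrable (\bigcup_i F i) (EFin \o f) ->
  \int[mu]_(x in \bigcup_i F i) f x = \sum_i \int[mu]_(x in F i) f x.
Proof.
move=> mN N0 tF iF; have mU := measurable_bigcup_fin.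
have iFi i : mu.-integrable (F i) (EFin \o f).
  by apply: integrableS iF => //; exact: bigcup_sup.
rewrite /Rintegral (negligible_integral mN mU iF N0).
have -> : \bigcup_i F i `\` N = \big[setU/set0]_(i <- index_enum I) (F i `\` N).
  rewrite setDE setI_bigcupl -bigcup_seq; apply: eq_bigcupl; split => i //= _.
  exact: mem_index_enum.
rewrite integral_bigsetU_EFin//.
- rewrite -sum_fine.
    by apply: eq_bigr => i _; rewrite [in RHS](negligible_integral mN (mF i) (iFi i) N0).
  move=> i _; apply: integrable_fin_num; first exact: measurableD.
  by apply: integrableS (iFi i) => //; exact: measurableD.
- by move=> i; exact: measurableD.
- exact: index_enum_uniq.
- exact: sub_trivIset tF.
- apply: measurable_int (integrableS _ _ _ iF) => //.
  + by apply: bigsetU_measurable => i _; exact: measurableD.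
  + by rewrite -bigcup_seq => x [i _ [Fx _]]; exists i.
Qed.

End finite_union.

(** * Nice polygons *)

Lemma odd_nextI (n : nat) (k : 'I_n) : ~~ odd n -> odd (nextI k) = ~~ odd k.
Proof. by move=> /negbTE en; rewrite /= odd_mod. Qed.

Lemma nextI_inj (n : nat) : injective (@nextI n).
Proof.
have nextE (k : 'I_n) : nextI k = ordS k by exact: val_inj.
by move=> i j; rewrite !nextE => /ordS_inj.
Qed.

(** The triangles whose first vertex has the wrong parity contribute their second vertex; since [n]
    is even, reindexing by [nextI] turns their sum into another copy of the sum over parity [b]. *)
Lemma sum_odd_nextI {R : realType} (n : nat) (b : bool) (a : 'I_n -> R) : ~~ odd n ->
  \sum_(k < n) (if odd k == b then a k else a (nextI k)) = 2 * \sum_(k < n | odd k == b) a k.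
Proof.
move=> en; rewrite (bigID (fun k : 'I_n => odd k == b))/= mulr2n mulrDl !mul1r.
congr (_ + _); first by apply: eq_bigr => i ->.
rewrite [RHS](reindex_inj (@nextI_inj n)); apply: eq_big => [k|k /negbTE -> //].
by rewrite odd_nextI//; case: odd; case: b.
Qed.

Lemma triangleC {R : realType} (O A B : pt R) : triangle O A B = triangle O B A.
Proof.
by apply/seteqP; split => x [s [t [s0 t0 st ->]]]; exists t, s; split => //;
  rewrite 1?addrC//; congr (_, _); ring.
Qed.

Lemma det2C {R : realType} (O A B : pt R) : det2 O B A = - det2 O A B.
Proof. by rewrite /det2; ring. Qed.

Section nice_polygon.
Context {R : realType} (n : nat) (A : 'I_n -> pt R) (O : pt R) (f : pt R -> R).
Context (en : ~~ odd n) (nP : nice_polygon A O).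
Context (cf : forall k : 'I_n, convex_on (triangle O (A k) (A (nextI k))) f).

Let d0 k : det2 O (A k) (A (nextI k)) != 0.
Proof. by case: nP => -[_ [H|H] _] _; [rewrite gt_eqF|rewrite lt_eqF]. Qed.

Lemma Rintegral_polygon (g : pt R -> R) :
  (forall k : 'I_n, convex_on (triangle O (A k) (A (nextI k))) g) ->
  \int[@leb2 R]_(x in polygon_region A O) g x =
  \sum_k \int[@leb2 R]_(x in triangle O (A k) (A (nextI k))) g x.
Proof.
move=> cg.
have mT k := measurable_triangle _ _ _ (d0 k).
have mU k := measurable_open_triangle _ _ _ (d0 k).
(* All triangle boundaries together; a point of two triangles outside [N] would lie in both open
   triangles, which are disjoint. *)
pose N := \bigcup_k (triangle O (A k) (A (nextI k)) `\` open_triangle O (A k) (A (nextI k))).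
apply: (Rintegral_bigcup_fin _ _ mT N).
- by apply: measurable_bigcup_fin => k; exact: measurableD.
- apply: bigcup_fin_null => k; first exact: measurableD.
  exact: leb2_triangle_boundary.
- apply/trivIsetP => k l _ _ kl.
  case: nP => -[_ _ /(_ _ _ kl) UU] _.
  apply/seteqP; split => // x [[Tk Nx] [Tl _]].
  rewrite -UU; split; apply: contrapT => Ux; apply: Nx; first by exists k.
  by exists l.
- apply: measurable_bounded_integrable.
  + exact: measurable_bigcup_fin.
  + by apply: bigcup_fin_lty => // k; rewrite /= leb2_triangle// ltry.
  + by apply: measurable_fun_bigcup_fin => // k; exact: measurable_convex_triangle.
  + by apply: bounded_bigcup_fin => k; exact: (bounded_convex_triangle _ _ _ (d0 k)).
Qed.

(** The parity [b] of the vertices at which [f] is evaluated is a parameter, so that one proof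
    covers both inequalities. *)
Lemma avg_area_polygon_le (b : bool) : avg_area (polygon_region A O) f <=
  1 / 3 * (1 / (n%:R / 2)) * (\sum_(k < n | odd k == b) f (A k))
  + 2 / 3 * (1 / (n%:R / 2)) * (\sum_(k < n | odd k == ~~ b) avg_seg f O (A k)).
Proof.
have n0 : (0 < n)%N by case: nP => -[n3 _ _] _; exact: leq_trans n3.
pose k0 : 'I_n := Ordinal n0.
(* Twice the common area of the triangles. *)
set D := `|det2 O (A k0) (A (nextI k0))|.
have D0 : 0 < D by rewrite normr_gt0.
have DE k : `|det2 O (A k) (A (nextI k))| = D.
  by case: nP => _ /(_ k k0); rewrite /tri_area -/D; lra.
have area : fine (@leb2 R (polygon_region A O)) = n%:R * (D / 2).
  have mT k := measurable_triangle _ _ _ (d0 k).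
  have mP : measurable (polygon_region A O : set (measurableTypeR R * measurableTypeR R)).
    exact: measurable_bigcup_fin.
  (* The area is the integral of the convex function 1, so it splits over the triangles like that of
     [f]. *)
  have := Rintegral_cst (@leb2 R) mP 1; rewrite mul1r => <-.
  rewrite (Rintegral_polygon (fun=> 1)); last by move=> k x y t _ _ _; lra.
  under eq_bigr => k _ do
    rewrite (Rintegral_cst (@leb2 R) (mT k)) /= leb2_triangle// DE mul1r.
  by rewrite sumr_const card_ord mulr_natl.
rewrite /avg_area area ler_pdivrMr; last first.
  by rewrite mulr_gt0 ?ltr0n// divr_gt0.
rewrite (Rintegral_polygon f)//.
have -> : (1 / 3 * (1 / (n%:R / 2)) * (\sum_(k < n | odd k == b) f (A k))
  + 2 / 3 * (1 / (n%:R / 2)) * (\sum_(k < n | odd k == ~~ b) avg_seg f O (A k)))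
  * (n%:R * (D / 2)) =
  \sum_(k < n) D * ((if odd k == b then f (A k) else f (A (nextI k))) / 6 +
    (if odd k == ~~ b then avg_seg f O (A k) else avg_seg f O (A (nextI k))) / 3).
  rewrite -mulr_sumr big_split/= -!mulr_suml.
  rewrite (sum_odd_nextI _ b (fun k => f (A k)))//.
  rewrite (sum_odd_nextI _ (~~ b) (fun k => avg_seg f O (A k)))//.
  by field; rewrite pnatr_eq0 -lt0n.
apply: ler_sum => k _; rewrite -(DE k).
have -> : (odd k == ~~ b) = ~~ (odd k == b) by case: odd; case: b.
case: ifPn => _ /=.
  (* [integral_convex_triangle] evaluates [f] at the last vertex, so the two vertices are exchanged
     when [A k] is the chosen one. *)
  rewrite triangleC -normrN -det2C; apply: integral_convex_triangle.
    by rewrite det2C oppr_eq0.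
  by rewrite triangleC.
exact: integral_convex_triangle.
Qed.

End nice_polygon.

Theorem theorem4p2 (R : realType) (n : nat) (A : 'I_n -> pt R) (O : pt R)
    (f : pt R -> R) :
  ~~ odd n ->
  nice_polygon A O ->
  (forall k : 'I_n, convex_on (triangle O (A k) (A (nextI k))) f) ->
  avg_area (polygon_region A O) f <=
    1 / 3 * (1 / (n%:R / 2)) * (\sum_(k < n | odd k) f (A k))
    + 2 / 3 * (1 / (n%:R / 2)) * (\sum_(k < n | ~~ odd k) avg_seg f O (A k))
  /\
  avg_area (polygon_region A O) f <=
    1 / 3 * (1 / (n%:R / 2)) * (\sum_(k < n | ~~ odd k) f (A k))
    + 2 / 3 * (1 / (n%:R / 2)) * (\sum_(k < n | odd k) avg_seg f O (A k)).
Proof.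
move=> en nP cf; split.
- have := avg_area_polygon_le _ _ _ _ en nP cf true.
  rewrite (eq_bigl (fun k : 'I_n => odd k)); last by move=> k; rewrite eqb_id.
  by rewrite [in X in _ + X](eq_bigl (fun k : 'I_n => ~~ odd k)) => // k; rewrite eqbF_neg.
- have := avg_area_polygon_le _ _ _ _ en nP cf false.
  rewrite (eq_bigl (fun k : 'I_n => ~~ odd k)); last by move=> k; rewrite eqbF_neg.
  by rewrite [in X in _ + X](eq_bigl (fun k : 'I_n => odd k)) => // k; rewrite eqb_id.
Qed.
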